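(* Let $X$ be a compact Riemannian manifold with distance $d$, let $\mu$ be a probability measure on $X$, and let $T:X\to X$ be a map preserving $\mu$. Let $p\in X$ be a periodic point of $T$ of period $\tau$, and suppose that $T$ is $C^1$ on an open neighborhood of the orbit of $p$. Suppose also that there exists $\gamma>0$ such that for $\mu$-a.e. $x\in X$ one has $T^n(x)\in B_{n^{-\gamma}}(p)$ for infinitely many $n$. Let $\varphi:X\to\mathbb{R}$ be a $\mu$-integrable observable which is continuous on $X\setminus\{p\}$ and satisfies $\lim_{x\to p}\varphi(x)=\infty$, $\int_X\varphi\,d\mu=0$, and $\varphi>-\rho$ for some $\rho>0$. Then the stationary stochastic process $\{\varphi\circ T^j\}_{j\ge 0}$ does not satisfy exponential large deviations with a rate function; that is, $\varphi$ does not satisfy a large deviation principle with a rate function.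
   Context: $B_r(p)$ denotes the ball of radius $r$ centered at $p$. For an observable $\varphi$ write $S_n(\varphi)=\varphi+\varphi\circ T+\dots+\varphi\circ T^{n-1}$. Definition. A mean-zero integrable function $\varphi:X\to\mathbb{R}$ is said to satisfy a large deviation principle with rate function $I$ if there exist a non-empty neighborhood $U\subset\mathbb{R}$ of $0$ and a strictly convex function $I:U\to\mathbb{R}$, non-negative and vanishing only at $\alpha=0$, such that $$\lim_{n\to\infty}\frac1n\log\mu\big(S_n(\varphi)\ge n\alpha\big)=-I(\alpha)\quad\text{for all }\alpha>0\text{ in }U,$$ $$\lim_{n\to\infty}\frac1n\log\mu\big(S_n(\varphi)\le n\alpha\big)=-I(\alpha)\quad\text{for all }\alpha<0\text{ in }U.$$ *)

(* Defs.v *)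
From HB Require Import structures.
From mathcomp Require Import all_boot all_order all_algebra.
From mathcomp Require Import all_classical all_reals all_analysis.

Set Implicit Arguments.
Unset Strict Implicit.
Unset Printing Implicit Defensive.

Import Order.TTheory GRing.Theory Num.Theory.
Import numFieldNormedType.Exports.

Local Open Scope classical_set_scope.
Local Open Scope ring_scope.

(* The library builds generated sigma-algebras on pointed types only; the base
   point carries no mathematical content. *)
#[short(type="pointedMetricType")]
HB.structure Definition PointedMetric (K : numDomainType) :=
  { M of Pointed M & Metric K M }.

Notation borel X := (g_sigma_algebraType (@open X)).

(* Meaningful when V is open, as in every use below. *)
Fixpoint Ck (R : realType) (E F : normedModType R) (k : nat) (V : set E)
    (f : E -> F) : Prop :=
  match k with
  | 0%N => forall x, V x -> {for x, continuous f}
  | m.+1 => (forall x, V x -> differentiable f x) /\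
            (forall v, Ck m V (fun x => 'D_v f x))
  end.

Definition smooth (R : realType) (E F : normedModType R) (V : set E)
    (f : E -> F) : Prop := forall k, Ck k V f.

Definition bilin (R : realType) (n : nat) (G : 'M[R]_n) (v w : 'rV[R]_n) : R :=
  (v *m G *m w^T) 0 0.

(* A smooth n-dimensional manifold without boundary is given by a C^oo atlas
   indexed by [atlas]: the i-th chart is the homeomorphism [coord i] from the
   open set [dom i] onto the open set [cod i] of R^n, with inverse [param i]
   (both functions are total, but only their values on [dom i] and [cod i]
   matter).  The Riemannian metric is given by its matrices [gram i] in the
   charts; [gram_change] is tensoriality, i.e. the invariance of the inner
   product of tangent vectors under the differential of chart transitions. *)
Record riemannian_atlas (R : realType) (n : nat) (X : metricType R) := {
  atlas : Type ;
  dom : atlas -> set X ;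
  cod : atlas -> set 'rV[R]_n ;
  coord : atlas -> X -> 'rV[R]_n ;
  param : atlas -> 'rV[R]_n -> X ;
  gram : atlas -> 'rV[R]_n -> 'M[R]_n ;
  dom_open : forall i, open (dom i) ;
  cod_open : forall i, open (cod i) ;
  dom_cover : forall x, exists i, dom i x ;
  coord_cod : forall i x, dom i x -> cod i (coord i x) ;
  param_dom : forall i u, cod i u -> dom i (param i u) ;
  coordK : forall i x, dom i x -> param i (coord i x) = x ;
  paramK : forall i u, cod i u -> coord i (param i u) = u ;
  coord_continuous : forall i x, dom i x -> {for x, continuous (coord i)} ;
  param_continuous : forall i u, cod i u -> {for u, continuous (param i)} ;
  transition_smooth : forall i j,
    smooth (cod i `&` param i @^-1` dom j) (coord j \o param i) ;
  gram_smooth : forall i, smooth (cod i) (gram i) ;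
  gram_sym : forall i u, cod i u -> (gram i u)^T = gram i u ;
  gram_pos : forall i u, cod i u ->
    forall v, v != 0 -> 0 < bilin (gram i u) v v ;
  gram_change : forall i j u, cod i u -> dom j (param i u) ->
    forall v w, bilin (gram i u) v w =
      bilin (gram j (coord j (param i u)))
            ('D_v (coord j \o param i) u) ('D_w (coord j \o param i) u)
}.

Section Riemannian.
Variables (R : realType) (n : nat) (X : metricType R).
Variable A : riemannian_atlas n X.

Definition arc_length (i : atlas A) (u : R -> 'rV[R]_n) : R :=
  \int[lebesgue_measure]_(t in `[0, 1])
    Num.sqrt (bilin (gram i (u t)) (derive1 u t) (derive1 u t)).

(* [curve_of_length x y l]: some piecewise C^1 curve from x to y has Riemannian
   length l.  A piecewise C^1 curve is given by consecutive C^1 arcs, each of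
   them read in a chart whose domain contains it: every piecewise C^1 curve can
   be so subdivided (Lebesgue number), reparametrization does not change the
   length, and a C^1 function on [0, 1] extends to a C^1 function on R. *)
Inductive curve_of_length : X -> X -> R -> Prop :=
| curve_nil x : curve_of_length x x 0
| curve_cons (i : atlas A) (u : R -> 'rV[R]_n) (y : X) (l : R) :
    Ck 1 [set: R] u ->
    (forall t, 0 <= t <= 1 -> cod i (u t)) ->
    curve_of_length (param i (u 1)) y l ->
    curve_of_length (param i (u 0)) y (arc_length i u + l).

(* X need not be connected: the distance of points in different components is
   only required to be compatible with the topology of X. *)
Definition riemannian_distance : Prop := forall x y,
  [set l | curve_of_length x y l] !=set0 ->
  mdist x y = inf [set l | curve_of_length x y l].

Definition C1_on (W : set X) (T : X -> X) : Prop :=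
  (forall x, W x -> {for x, continuous T}) /\
  forall i j : atlas A, Ck 1 (cod i `&` param i @^-1` (W `&` T @^-1` dom j))
                             (coord j \o T \o param i).

End Riemannian.

Section LargeDeviations.
Context {R : realType} {d : measure_display} {X : measurableType d}.
Variables (mu : probability X R) (T : X -> X).

Definition preserves : Prop :=
  measurable_fun setT T /\
  forall A, measurable A -> mu (T @^-1` A) = mu A.

Definition birkhoff_sum (phi : X -> R) (n : nat) (x : X) : R :=
  \sum_(0 <= k < n) phi (iter k T x).

Definition strictly_convex_on (U : set R) (I : R -> R) : Prop :=
  is_interval U /\
  forall a b t, U a -> U b -> a != b -> 0 < t < 1 ->
    I (t * a + (1 - t) * b) < t * I a + (1 - t) * I b.

(* [lne] is the logarithm with lne 0 = -oo; only the values of [I] on [U]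
   matter. *)
Definition satisfies_LDP (phi : X -> R) : Prop :=
  exists (U : set R) (I : R -> R),
    [/\ nbhs 0 U /\ strictly_convex_on U I,
        forall a, U a -> 0 <= I a,
        forall a, U a -> (I a = 0 <-> a = 0),
        forall a, U a -> 0 < a ->
          ((n%:R^-1)%:E *
             lne (mu [set x | (n%:R * a <= birkhoff_sum phi n x)%R]))%E
            @[n --> \oo] --> (- I a)%:E &
        forall a, U a -> a < 0 ->
          ((n%:R^-1)%:E *
             lne (mu [set x | (birkhoff_sum phi n x <= n%:R * a)%R]))%E
            @[n --> \oo] --> (- I a)%:E].

End LargeDeviations.

(* Main.v *)
(** In charts, [T] is Lipschitz at each point of the orbit of [p], so a point
    within k^-gamma of [p] stays close to [p] under the first c log k iterates of
    T^tau, where [phi] is as large as we please; as [phi] is bounded below, its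
    Birkhoff sum of length Q log k (with Q large) then exceeds Q alpha log k.
    Points whose orbit comes that close to [p] infinitely often, yet avoids [p],
    thus visit [S_(Q l) >= Q l alpha] before time B^(l+1) for infinitely many l.
    If large deviations were exponentially unlikely, invariance and
    Borel-Cantelli would make these points negligible: [mu] would be carried by
    the orbit of [p], on which [S_n >= n alpha] has measure 0 or 1 whenever tau
    divides n, and neither value has a finite positive exponential rate. *)

Require Import Defs.
From mathcomp Require Import all_boot all_order all_algebra.
From mathcomp Require Import all_classical all_reals all_analysis.
From mathcomp Require Import ring lra.
Import Order.TTheory GRing.Theory Num.Theory.
Import numFieldNormedType.Exports.
(* Imported again because [coord] is also a constant of vector.v. *)
Import Defs.

Set Implicit Arguments.
Unset Strict Implicit.
Unset Printing Implicit Defensive.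

Local Open Scope classical_set_scope.
Local Open Scope ring_scope.

(** * Riemannian versus coordinate norms of tangent vectors *)

Section BilinBounds.
Variables (R : realType) (n : nat).
Implicit Types (G : 'M[R]_n) (v w : 'rV[R]_n).

Lemma mx_entry_le_norm m k (M : 'M[R]_(m, k)) i j : `|M i j| <= `|M|.
Proof.
rewrite [leRHS]mx_normrE.
exact: (le_bigmax _ (fun ij : 'I_m * 'I_k => `|M ij.1 ij.2|) (i, j)).
Qed.

Lemma bilinE G v w :
  bilin G v w = \sum_j (\sum_i v 0 i * G i j) * w 0 j.
Proof. by rewrite /bilin mxE; apply: eq_bigr => j _; rewrite !mxE. Qed.

Lemma bilinBl G H v w : bilin (G - H) v w = bilin G v w - bilin H v w.
Proof. by rewrite /bilin mulmxBr mulmxBl !mxE. Qed.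

Lemma bilinZZ G a v : bilin G (a *: v) (a *: v) = a ^+ 2 * bilin G v v.
Proof.
by rewrite /bilin linearZ /= -!scalemxAl -scalemxAr !mxE mulrA -expr2.
Qed.

(** All norms here are maxima of entries, so each of the [n ^ 2] terms of the double sum is at most
    the product of the three norms. *)
Lemma bilin_le_norm G v w :
  `|bilin G v w| <= (n ^ 2)%:R * `|G| * `|v| * `|w|.
Proof.
rewrite bilinE; apply: (le_trans (ler_norm_sum _ _ _)).
apply: (@le_trans _ _ (\sum_(j < n) (n%:R * (`|v| * `|G|)) * `|w|)).
  apply: ler_sum => j _; rewrite normrM ler_pM ?mx_entry_le_norm//.
  apply: (le_trans (ler_norm_sum _ _ _)).
  apply: (@le_trans _ _ (\sum_(i < n) (`|v| * `|G|))); last first.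
    by rewrite sumr_const card_ord mulr_natl.
  by apply: ler_sum => i _; rewrite normrM ler_pM ?mx_entry_le_norm.
rewrite sumr_const card_ord -mulr_natl natrX expr2.
rewrite le_eqVlt; apply/orP; left; apply/eqP; ring.
Qed.

Lemma continuous_bilin (T : topologicalType) (gm : T -> 'M[R]_n)
    (v w : T -> 'rV[R]_n) (x : T) :
  {for x, continuous gm} -> {for x, continuous v} -> {for x, continuous w} ->
  {for x, continuous (fun x => bilin (gm x) (v x) (w x))}.
Proof.
move=> gc vc wc.
rewrite (_ : (fun x => _) =
    fun x => \sum_j (\sum_i v x 0 i * gm x i j) * w x 0 j); last first.
  by apply/funext => y; exact: bilinE.
have sumc (F : 'I_n -> T -> R) : (forall i, {for x, continuous (F i)}) ->
    {for x, continuous (fun y => \sum_i F i y)}.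
  move=> Fc; apply: (@cvg_big _ _ +%R 0 xpredT _ _ (nbhs x) _ F (F^~ x)) => [|i _].
    exact: add_continuous.
  exact: Fc.
have entryc m k (M : T -> 'M[R]_(m, k)) i j : {for x, continuous M} ->
    {for x, continuous (fun y => M y i j)}.
  move=> Mc; apply: (@continuous_comp _ _ _ M (fun B => B i j)) => //.
  exact: matrix_normedtype.coord_continuous.
apply: (sumc (fun j y => (\sum_i v y 0 i * gm y i j) * w y 0 j)) => j.
apply: (continuousM _ (entryc _ _ w 0 j wc)).
apply: (sumc (fun i y => v y 0 i * gm y i j)) => i.
exact: continuousM (entryc _ _ v 0 i vc) (entryc _ _ gm i j gc).
Qed.

(** The unit sphere is compact, so the form attains a minimum there, which is positive; homogeneity
    of degree 2 carries the bound to every [v]. *)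
Lemma bilin_pos_sphere G : (forall v, v != 0 -> 0 < bilin G v v) ->
  exists2 c, 0 < c & forall v, c * `|v| ^+ 2 <= bilin G v v.
Proof.
move=> Gpos; pose S := [set v : 'rV[R]_n | `|v| = 1].
have bilin0 : bilin G 0 0 = 0 by rewrite /bilin !mul0mx mxE.
(* The sphere is empty only in dimension 0, where [v = 0] and any constant works. *)
have [S0|/set0P Sn0] := eqVneq S set0.
  exists 1 => // v; have [->|v0] := eqVneq v 0.
    by rewrite normr0 expr2 !mulr0 bilin0.
  suff : S (`|v|^-1 *: v) by rewrite S0.
  by rewrite /S /= normrZ normfV normr_id mulVf// normr_eq0.
have Scpt : compact S.
  apply: bounded_closed_compact.
    by exists 1; split => // x x1 v /= ->; exact: ltW.
  have -> : S = (fun v : 'rV[R]_n => `|v|) @^-1` [set 1] by [].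
  by apply: closed_comp; [move=> v _; exact: norm_continuous|exact: closed_eq].
have cS : {within S, continuous (fun v => bilin G v v)}.
  apply: continuous_subspaceT => v.
  by apply: continuous_bilin => //; exact: cst_continuous.
have [v0 Sv0 v0min] := EVT_min_rV Sn0 Scpt cS.
exists (bilin G v0 v0).
  apply: Gpos; apply/eqP => v00; move: Sv0.
  by rewrite inE /S/= v00 normr0 => /esym/eqP; rewrite oner_eq0.
move=> v; have [->|vn0] := eqVneq v 0.
  by rewrite normr0 expr2 !mulr0 bilin0.
have nv0 : 0 < `|v| by rewrite normr_gt0.
have -> : bilin G v v = `|v| ^+ 2 * bilin G (`|v|^-1 *: v) (`|v|^-1 *: v).
  by rewrite bilinZZ mulrA -exprMn mulfV ?gt_eqF// expr1n mul1r.
rewrite mulrC ler_pM2l ?exprn_gt0//; apply: v0min.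
by rewrite inE /S /= normrZ normfV normr_id mulVf// gt_eqF.
Qed.

(** A perturbation of the matrix by less than [c / (2 * K)] changes the form by at most
    [c / 2 * |v|^2], so half of the lower bound at [u0] survives on a neighbourhood that does not
    depend on [v]. *)
Lemma bilin_pos_near (gm : 'rV[R]_n -> 'M[R]_n) (u0 : 'rV[R]_n) :
  {for u0, continuous gm} -> (forall v, v != 0 -> 0 < bilin (gm u0) v v) ->
  exists c C : R, [/\ 0 < c, 0 < C &
    \forall u \near u0, forall v,
      c * `|v| <= Num.sqrt (bilin (gm u) v v) <= C * `|v|].
Proof.
move=> gmc gmpos; have [c c0 hc] := bilin_pos_sphere gmpos.
(* The added 1 keeps [K] positive when [n = 0]. *)
pose K : R := (n ^ 2)%:R + 1.
have K0 : 0 < K by rewrite ltr_wpDl.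
have cK0 : 0 < c / (2 * K) by rewrite divr_gt0// mulr_gt0.
exists (Num.sqrt (c / 2)), (Num.sqrt (K * (`|gm u0| + c / (2 * K)))); split.
- by rewrite sqrtr_gt0 divr_gt0.
- by rewrite sqrtr_gt0 mulr_gt0// ltr_wpDl.
have near_gm : \forall u \near u0, `|gm u0 - gm u| < c / (2 * K).
  by move/cvgrPdist_lt: gmc; apply.
near=> u => v.
have hu : `|gm u0 - gm u| < c / (2 * K) by near: u.
have hu' : `|gm u| <= `|gm u0| + c / (2 * K).
  rewrite -lerBlDl; apply: le_trans (ltW hu); rewrite distrC.
  exact: lerB_dist.
have nK : (n ^ 2)%:R <= K by rewrite lerDl.
have lo : c / 2 * `|v| ^+ 2 <= bilin (gm u) v v.
  have := bilin_le_norm (gm u0 - gm u) v v; rewrite bilinBl.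
  move=> /(le_trans (ler_norm _)).
  rewrite -[X in _ <= X]mulrA -expr2 => h1.
  have h2 : (n ^ 2)%:R * `|gm u0 - gm u| * `|v| ^+ 2 <= c / 2 * `|v| ^+ 2.
    rewrite ler_wpM2r ?exprn_ge0//.
    apply: (@le_trans _ _ (K * (c / (2 * K)))).
      by rewrite ler_pM// ltW.
    rewrite invfM mulrC -!mulrA mulVf ?gt_eqF// mulr1//.
  have := hc v; set X := _ ^+ 2 in h1 h2 *.
  have -> : c = c / 2 + c / 2 by lra.
  rewrite mulrDl; lra.
have hi : bilin (gm u) v v <= K * (`|gm u0| + c / (2 * K)) * `|v| ^+ 2.
  apply: (le_trans (ler_norm _)); apply: (le_trans (bilin_le_norm _ _ _)).
  rewrite -[X in X <= _]mulrA -expr2 ler_wpM2r ?exprn_ge0//.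
  by rewrite ler_pM.
have sqn a : 0 <= a -> Num.sqrt a * `|v| = Num.sqrt (a * `|v| ^+ 2).
  by move=> a0; rewrite sqrtrM// sqrtr_sqr normr_id.
rewrite !sqn; first by rewrite !ler_wsqrtr.
  by rewrite mulr_ge0 ?addr_ge0// ltW.
by rewrite divr_ge0// ltW.
Unshelve. all: by end_near. Qed.

End BilinBounds.

(** * A mean value inequality for one-sided derivatives *)

Section DiniIntegral.
Variable R : realType.
Notation leb := (@lebesgue_measure R).

(** The supremum of the [t] such that [P] holds on [[a, t]] is such a [t] by the last hypothesis;
    were it below [b], the hypothesis on right neighbourhoods would push it further. *)
Lemma real_induction (P : R -> Prop) (a b : R) : a <= b -> P a ->
  (forall t, a <= t < b -> (forall s, a <= s <= t -> P s) ->
     \forall s \near t^'+, P s) ->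
  (forall t, a < t <= b -> (forall s, a <= s < t -> P s) -> P t) ->
  P b.
Proof.
move=> ab Pa Pr Pl.
pose S := [set t | a <= t <= b /\ forall s, a <= s <= t -> P s].
have Sa : S a.
  by split=> [|s]; rewrite ?lexx// -eq_le => /eqP <-.
have hS : has_sup S by split; [exists a|exists b => t [/andP[]]].
have aS : a <= sup S by apply: ub_le_sup hS.2 _ Sa.
have Sb : sup S <= b by apply: ge_sup hS.1 _ => t [/andP[]].
have PltS s : a <= s < sup S -> P s.
  move=> /andP[as_ sS].
  have [t [_ Pt] st] := sup_gt hS.1 sS.
  by apply: Pt; rewrite as_ ltW.
have PS : P (sup S).
  have [<-//|aS'] := eqVneq a (sup S).
  by apply: Pl => //; rewrite lt_neqAle aS' aS.
have PleS s : a <= s <= sup S -> P s.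
  move=> /andP[as_]; rewrite le_eqVlt => /predU1P[->//|sS].
  by apply: PltS; rewrite as_.
have [Sbe|Sb'] := eqVneq (sup S) b; first by rewrite -Sbe.
have SB : sup S < b by rewrite lt_neqAle Sb' Sb.
have SS : \forall s \near (sup S)^'+, P s by apply: Pr PleS; rewrite aS.
have [e /= e0 he] := SS.
pose t := Num.min b (sup S + e / 2).
have St : sup S < t by rewrite lt_min SB ltrDl divr_gt0.
have : S t.
  split; first by rewrite (le_trans aS (ltW St)) ge_min lexx.
  move=> s /andP[as_ st].
  have [sS|Ss] := leP s (sup S); first by apply: PleS; rewrite as_.
  apply: he => //=; rewrite ltr0_norm ?subr_lt0// opprB ltrBlDl.
  apply: (le_lt_trans st); rewrite gt_min; apply/orP; right.
  by rewrite ltrD2l ltr_pdivrMr// ltr_pMr// ltr1n.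
by move=> /(ub_le_sup hS.2); rewrite leNgt St.
Qed.

(* The right derivative bound need not hold for a continuous [g]: lower
   semicontinuity from the left is enough. *)
Lemma ler_dini_integral (g h : R -> R) :
  {within `[0, 1], continuous h} ->
  (forall t e, 0 < t <= 1 -> 0 < e -> \forall s \near t^'-, g t <= g s + e) ->
  (forall t e, 0 <= t < 1 -> 0 < e ->
     \forall s \near t^'+, g s - g t <= (h t + e) * (s - t)) ->
  g 1 - g 0 <= \int[leb]_(t in `[0, 1]) h t.
Proof.
move=> hc glsc gdini.
have hint : leb.-integrable `[0, 1] (EFin \o h).
  by apply: continuous_compact_integrable => //; exact: segment_compact.
have hintS a b : 0 <= a -> b <= 1 -> leb.-integrable `[a, b] (EFin \o h).
  move=> a0 b1; apply: integrableS hint => //.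
  by apply: subset_itv; rewrite bnd_simp.
pose F t := \int[leb]_(x in `[0, t]) h x.
have FB t s : 0 <= t -> t <= s -> s <= 1 ->
    F s - F t = \int[leb]_(x in `]t, s]) h x.
  move=> t0 ts s1; rewrite /F Rintegral_itvB ?bnd_simp//.
  exact: hintS.
apply/ler_addgt0Pl => e e0.
(* The slack is spread as [e * t]. On a short step to the right, half of it pays for the error in
   the derivative bound of [g] and half for the variation of [h]. *)
suff : g 1 - g 0 <= F 1 + e * 1 by rewrite mulr1 [F 1 + _]addrC.
have e20 : 0 < e / 2 by rewrite divr_gt0.
apply: (@real_induction (fun t => g t - g 0 <= F t + e * t) 0 1) => //.
- by rewrite subrr /F set_itv1 Rintegral_set1 mulr0 addr0.
- move=> t /andP[t0 t1] /(_ t); rewrite t0 lexx => /(_ isT) IH.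
  have hcr : h x @[x --> t^'+] --> h t.
    have : {within `[t, 1], continuous h}.
      apply: continuous_subspaceW hc.
      by apply: subset_itv; rewrite bnd_simp.
    by case/(continuous_within_itvP _ t1).
  have [d /= d0 hd] : \forall s \near t^'+, h t - e / 2 <= h s.
    move/cvgrPdist_le : hcr => /(_ _ e20); apply: filterS => s.
    by rewrite ler_norml; lra.
  have gd := gdini t (e / 2); rewrite t0 t1 in gd.
  move: (gd isT e20) => gdt.
  near=> s.
  have ts : t < s by near: s; exact: nbhs_right_gt.
  have s1 : s <= 1 by near: s; exact: nbhs_right_le.
  have sd : s < t + d by near: s; apply: nbhs_right_lt; rewrite ltrDl.
  have h1 : g s - g t <= (h t + e / 2) * (s - t) by near: s.
  have h2 : (h t - e / 2) * (s - t) <= F s - F t.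
    rewrite FB ?(ltW ts)//.
    have -> : s - t = fine (leb `]t, s]%classic).
      by rewrite lebesgue_measure_itv/= lte_fin ts -EFinB.
    rewrite -Rintegral_cst//; apply: le_Rintegral => //.
    - have ic : leb.-integrable `[t, s] (EFin \o (fun=> h t - e / 2)).
        apply: continuous_compact_integrable; first exact: segment_compact.
        by apply: continuous_subspaceT => x; exact: cst_continuous.
      by apply: integrableS ic => //; apply: subset_itv; rewrite bnd_simp.
    - apply: integrableS (hintS t s t0 s1) => //.
      by apply: subset_itv; rewrite bnd_simp.
    - move=> x /=; rewrite in_itv/= => /andP[tx xs]; apply: hd => //=.
      rewrite ltr0_norm ?subr_lt0// opprB ltrBlDl; exact: le_lt_trans sd.
  have h3 : (h t + e / 2) * (s - t) = (h t - e / 2) * (s - t) + e * (s - t).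
    by field.
  rewrite h3 in h1; lra.
- move=> t /andP[t0 t1] IH; apply/ler_addgt0Pl => e' e'0.
  have e'20 : 0 < e' / 2 by rewrite divr_gt0.
  have Fl : F x @[x --> t^'-] --> F t.
    have := parameterized_integral_continuous (ltW t0) (hintS 0 t (lexx _) t1).
    by case/(continuous_within_itvP _ t0).
  have gt := glsc t (e' / 2); rewrite t0 t1 in gt; move: (gt isT e'20) => {}gt.
  have Flt : \forall s \near t^'-, F s <= F t + e' / 2.
    move/cvgrPdist_le : Fl => /(_ _ e'20); apply: filterS => s.
    by rewrite ler_norml; lra.
  have : \forall s \near t^'-, g t - g 0 <= e' + (F t + e * t).
    near=> s.
    have s0 : 0 <= s by near: s; exact: nbhs_left_ge.
    have st : s < t by near: s; exact: nbhs_left_lt.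
    have gs : g t <= g s + e' / 2 by near: s.
    have Fs : F s <= F t + e' / 2 by near: s.
    have := IH s; rewrite s0 st => /(_ isT).
    have : e * s <= e * t by rewrite ler_pM2l// ltW.
    lra.
  by move=> /(@filter_ex _ _ _ ) [].
Unshelve. all: by end_near. Qed.

End DiniIntegral.

Lemma derivable_norm_le (R : realType) (V : normedModType R) (w : R -> V) t e :
  derivable w t 1 -> 0 < e ->
  \forall s \near t^'+, `|w s - w t| <= (`|'D_1 w t| + e) * (s - t).
Proof.
move=> /cvgrPdist_le /[apply] -[d /= d0 hd].
near=> s.
have ts : t < s by near: s; exact: nbhs_right_gt.
have std : s < t + d by near: s; apply: nbhs_right_lt; rewrite ltrDl.
have st0 : 0 < s - t by rewrite subr_gt0.
have := hd (s - t); rewrite /= sub0r normrN gtr0_norm// ltrBlDl.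
move=> /(_ std) /(_ (lt0r_neq0 st0)).
rewrite /= scaler1 subrK => hq.
have -> : w s - w t = (s - t) *: ((s - t)^-1 *: (w s - w t)).
  by rewrite scalerA divff ?lt0r_neq0// scale1r.
rewrite normrZ gtr0_norm// mulrC ler_pM2r// -lerBlDl.
by apply: le_trans hq; rewrite distrC; exact: lerB_dist.
Unshelve. all: by end_near. Qed.

(** * Speed and length of C^1 arcs *)

Section Arcs.
Variables (R : realType) (n : nat) (X : metricType R).
Variable A : riemannian_atlas n X.

Lemma gram_continuous (i : atlas A) u : cod i u -> {for u, continuous (gram i)}.
Proof. by move=> cu; exact: (gram_smooth i 0%N). Qed.

Lemma C1_arc_continuous (u : R -> 'rV[R]_n) t : Ck 1 [set: R] u ->
  {for t, continuous u} /\ {for t, continuous (derive1 u)}.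
Proof.
move=> [ud uD]; split; first exact/differentiable_continuous/ud.
have -> : derive1 u = fun t => 'D_1 u t.
  by apply/funext => s; rewrite derive1E.
exact: uD.
Qed.

Lemma speed_continuous (i : atlas A) (u : R -> 'rV[R]_n) t :
  Ck 1 [set: R] u -> cod i (u t) ->
  {for t, continuous (fun t =>
     Num.sqrt (bilin (gram i (u t)) (derive1 u t) (derive1 u t)))}.
Proof.
move=> uC1 cu; have [uc duc] := C1_arc_continuous t uC1.
apply: (@continuous_comp _ _ _
  (fun t => bilin (gram i (u t)) (derive1 u t) (derive1 u t))); last first.
  exact: sqrt_continuous.
apply: continuous_bilin => //.
by apply: (continuous_comp uc); exact: gram_continuous.
Qed.

Lemma arc_length_ge0 (i : atlas A) (u : R -> 'rV[R]_n) : 0 <= arc_length i u.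
Proof. by apply: Rintegral_ge0 => t _; exact: sqrtr_ge0. Qed.

Lemma curve_of_length_ge0 x y l : curve_of_length A x y l -> 0 <= l.
Proof.
by elim=> // i u {}y {}l _ _ _ l0; rewrite addr_ge0// arc_length_ge0.
Qed.

End Arcs.

(** * Lower bounds on the length of curves *)

Section TruncatedChartDistance.
Variables (R : realType) (n : nat) (X : metricType R).
Variable A : riemannian_atlas n X.

Lemma chart_norm_continuous (i : atlas A) (u0 : 'rV[R]_n) x : dom i x ->
  {for x, continuous (fun y => `|coord i y - u0|)}.
Proof.
move=> dx; apply: (@continuous_comp _ _ _ (fun y => coord i y - u0)).
  apply: (continuousB (coord_continuous dx)); exact: cst_continuous.
exact: norm_continuous.
Qed.

Lemma chart_ball_closed (i : atlas A) (u0 : 'rV[R]_n) (s : R) :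
  (forall u, `|u - u0| <= s -> cod i u) ->
  closed [set x | dom i x /\ `|coord i x - u0| <= s].
Proof.
move=> hs; pose B := [set u : 'rV[R]_n | `|u - u0| <= s].
have -> : [set x | dom i x /\ `|coord i x - u0| <= s] = param i @` B.
  apply/seteqP; split=> [x [dx xs]|_ [u us <-]].
    by exists (coord i x) => //; exact: coordK.
  by split; [exact/param_dom/hs|rewrite paramK//; exact: hs].
apply: compact_closed; first exact: metric_hausdorff.
apply: continuous_compact.
  apply: continuous_in_subspaceT => u; rewrite inE => us.
  by apply: param_continuous; exact: hs.
apply: bounded_closed_compact.
  exists (`|u0| + s); split; [exact: num_real|move=> M ltM u us]; apply/ltW/(le_lt_trans _ ltM).
  rewrite addrC -lerBlDr; apply: le_trans us; exact: lerB_dist.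
have Bc : continuous (fun u : 'rV[R]_n => `|u - u0|).
  move=> u; apply: (@continuous_comp _ _ _ (fun u : 'rV[R]_n => u - u0)).
    by apply: continuousB => //; exact: cst_continuous.
  exact: norm_continuous.
have -> : B = (fun u => `|u - u0|) @^-1` [set t | t <= s] by [].
by apply: closed_comp => [u _|]; [exact: Bc|exact: closed_le].
Qed.

(* Along any curve, [c * trunc_coord_dist] grows at most at the Riemannian speed,
   in whichever charts the curve is read; this bounds lengths from below. *)
Definition trunc_coord_dist (i : atlas A) (u0 : 'rV[R]_n) (r : R) (x : X) : R :=
  if `[< dom i x /\ `|coord i x - u0| <= r >] then `|coord i x - u0| else r.

Section Fixed.
Variables (i : atlas A) (u0 : 'rV[R]_n) (r c : R).
Hypothesis c0 : 0 < c.
Hypothesis r_cod : forall u, `|u - u0| <= r -> cod i u.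
Hypothesis r_gram : forall u, `|u - u0| <= r -> forall v,
  c * `|v| <= Num.sqrt (bilin (gram i u) v v).
Local Notation f := (trunc_coord_dist i u0 r).

Lemma trunc_coord_distE x : dom i x -> `|coord i x - u0| <= r ->
  f x = `|coord i x - u0|.
Proof.
by move=> dx xr; rewrite /trunc_coord_dist; case: asboolP => // -[].
Qed.

Lemma trunc_coord_dist_le x : f x <= r.
Proof. by rewrite /trunc_coord_dist; case: asboolP => // -[]. Qed.

Lemma trunc_coord_dist_lt x : f x < r -> dom i x /\ f x = `|coord i x - u0|.
Proof.
by rewrite /trunc_coord_dist; case: asboolP => [[]|_]//; rewrite ltxx.
Qed.

(* Chart balls are closed in [X] because they are compact and [X] is Hausdorff. *)
Lemma trunc_coord_dist_lsc x e : 0 < e -> \forall y \near x, f x <= f y + e.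
Proof.
move=> e0; pose a := f x - e.
have ar : a < r by rewrite ltrBlDr (le_lt_trans (trunc_coord_dist_le x))// ltrDl.
have acod u : `|u - u0| <= a -> cod i u.
  by move=> ua; apply/r_cod/(le_trans ua)/ltW.
have := chart_ball_closed acod; rewrite -openC openE => /(_ x) nx.
apply: filterS (nx _); last first.
  move=> /= -[dx xa].
  have := trunc_coord_distE dx (le_trans xa (ltW ar)) => fx.
  by move: xa; rewrite /a -fx; lra.
move=> y /= hy; rewrite leNgt; apply/negP => fy; apply: hy.
have fya : f y < a by rewrite /a; lra.
have [dy fyE] := trunc_coord_dist_lt (lt_trans fya ar).
by split=> //; rewrite -fyE ltW.
Qed.

(** Where [f] equals its maximum [r] it cannot grow. Where [f < r], chart [i] stays available just
    after [t]: the chain rule gives the velocity in chart [i], and [gram_change] identifies its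
    Riemannian norm with the speed read in chart [j]. Thus arcs that leave chart [i] are covered
    too. *)
Lemma trunc_coord_dist_arc (j : atlas A) (u : R -> 'rV[R]_n) :
  Ck 1 [set: R] u -> (forall t, 0 <= t <= 1 -> cod j (u t)) ->
  c * f (param j (u 1)) - c * f (param j (u 0)) <= arc_length j u.
Proof.
move=> uC1 ucod.
have pc t : 0 <= t <= 1 -> {for t, continuous (param j \o u)}.
  move=> t01; have [uc _] := C1_arc_continuous t uC1.
  by apply: (continuous_comp uc); apply: param_continuous; exact: ucod.
apply: (ler_dini_integral (g := fun t => c * f (param j (u t)))).
- apply: continuous_in_subspaceT => t; rewrite inE/= in_itv/= => t01.
  by apply: speed_continuous => //; exact: ucod.
- move=> t e /andP[t0 t1] e0.
  have ec0 : 0 < e / c by rewrite divr_gt0.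
  have t01 : 0 <= t <= 1 by rewrite ltW.
  suff near_x : \forall y \near param j (u t), c * f (param j (u t)) <= c * f y + e.
    exact: (cvg_at_left_filter (pc t t01) near_x).
  have := trunc_coord_dist_lsc (param j (u t)) ec0.
  apply: filterS => y fy.
  rewrite -[e in leRHS](divfK (lt0r_neq0 c0)) [_ / c * c]mulrC.
  by rewrite -mulrDr ler_pM2l.
- move=> t e /andP[t0 t1] e0.
  have t01 : 0 <= t <= 1 by rewrite t0 ltW.
  set x := param j (u t); set h := Num.sqrt _.
  have h0 : 0 <= h by exact: sqrtr_ge0.
  have [rx|xr] := leP r (f x).
    near=> s.
    have ts : t < s by near: s; exact: nbhs_right_gt.
    apply: (@le_trans _ _ 0).
      rewrite -mulrBr pmulr_rle0// subr_le0.
      exact: le_trans (trunc_coord_dist_le _) rx.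
    by apply: mulr_ge0; [rewrite addr_ge0// ltW|rewrite subr_ge0 ltW].
  have [dx fx] := trunc_coord_dist_lt xr.
  pose F := coord i \o param j.
  have Fd : differentiable F (u t).
    have [Fd _] := transition_smooth j i 1.
    by apply: Fd; split => //; exact: ucod.
  have ud : differentiable u t by exact: uC1.1.
  have wd : differentiable (F \o u) t by exact: differentiable_comp.
  have ec0 : 0 < e / c by rewrite divr_gt0.
  have hw := derivable_norm_le (diff_derivable wd) ec0.
  have w'E : 'D_1 (F \o u) t = 'D_(derive1 u t) F (u t).
    rewrite derive1E (deriveE _ wd) (deriveE _ Fd) (deriveE _ ud).
    exact: (congr1 (fun k => k 1) (diff_comp ud Fd)).
  have w'h : c * `|'D_1 (F \o u) t| <= h.
    have xr' : `|coord i x - u0| <= r by rewrite -fx ltW.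
    have gc := gram_change (ucod t t01) dx (derive1 u t) (derive1 u t).
    rewrite w'E; apply: (le_trans (r_gram xr' _)).
    rewrite le_eqVlt; apply/orP; left; apply/eqP/(congr1 Num.sqrt).
    exact: esym gc.
  have near_x : \forall y \near x, dom i y /\ `|coord i y - u0| <= r.
    apply: filterI; first by apply: open_nbhs_nbhs; split=> //; exact: dom_open.
    have := chart_norm_continuous (u0 := u0) dx; rewrite fx in xr.
    by move=> /cvgr_lt /(_ r xr); apply: filterS => y /ltW.
  have near_t : \forall s \near t^'+, dom i (param j (u s)) /\
      `|coord i (param j (u s)) - u0| <= r.
    exact: (cvg_at_right_filter (pc t t01) near_x).
  near=> s.
  have [dxs xsr] : dom i (param j (u s)) /\
    `|coord i (param j (u s)) - u0| <= r by near: s.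
  have ts : t < s by near: s; exact: nbhs_right_gt.
  have ws : `|F (u s) - F (u t)| <= (`|'D_1 (F \o u) t| + e / c) * (s - t).
    by near: s.
  rewrite (trunc_coord_distE dxs xsr) fx -mulrBr.
  apply: (@le_trans _ _ (c * `|F (u s) - F (u t)|)).
    rewrite ler_pM2l//; apply: le_trans (lerB_dist _ _) _.
    by rewrite opprB addrA subrK.
  apply: (@le_trans _ _ (c * ((`|'D_1 (F \o u) t| + e / c) * (s - t)))).
    by rewrite ler_pM2l.
  rewrite mulrA ler_pM2r ?subr_gt0// mulrDr lerD// mulrC divfK// gt_eqF.
Unshelve. all: by end_near. Qed.

Lemma trunc_coord_dist_curve x y l : curve_of_length A x y l ->
  c * f y - c * f x <= l.
Proof.
elim=> [z|j u z {}l uC1 ucod _ IH]; first by rewrite subrr.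
have := trunc_coord_dist_arc uC1 ucod; lra.
Qed.

End Fixed.
End TruncatedChartDistance.

(** * Upper bounds on distances, by straight segments in a chart *)

Section StraightSegments.
Variables (R : realType) (n : nat) (X : metricType R).
Variable A : riemannian_atlas n X.
Notation leb := (@lebesgue_measure R).

Lemma derive_segment (V : normedModType R) (a b : V) (x v : R) :
  (fun h => h^-1 *: ((a + (h *: v + x) *: b) - (a + x *: b))) @ 0^' --> v *: b.
Proof.
apply: cvg_near_cst; near=> h.
have h0 : h != 0 by near: h; exact: nbhs_dnbhs_neq.
rewrite opprD addrACA subrr add0r scalerDl addrK !scalerA.
by congr (_ *: _); rewrite mulrA mulVf// mul1r.
Unshelve. all: by end_near. Qed.

Lemma segment_C1 (V : normedModType R) (a b : V) :
  Ck 1 [set: R] (fun t : R => a + t *: b).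
Proof.
split=> [x _|v x _].
  apply/derivable1_diffP/cvg_ex; exists (1 *: b); exact: derive_segment.
have -> : 'D_v (fun t : R => a + t *: b) = fun=> v *: b.
  by apply/funext => y; apply/cvg_lim => //; exact: derive_segment.
exact: cst_continuous.
Qed.

Lemma derive1_segment (V : normedModType R) (a b : V) t :
  derive1 (fun t : R => a + t *: b) t = b.
Proof.
by rewrite derive1E -[RHS]scale1r; apply/cvg_lim => //; exact: derive_segment.
Qed.

Lemma segment_curve (i : atlas A) (u0 u1 : 'rV[R]_n) (r C : R) :
  (forall u, `|u - u0| <= r -> cod i u) ->
  (forall u, `|u - u0| <= r -> forall v,
     Num.sqrt (bilin (gram i u) v v) <= C * `|v|) ->
  `|u1 - u0| <= r ->
  exists2 l, curve_of_length A (param i u0) (param i u1) l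
           & l <= C * `|u1 - u0|.
Proof.
move=> rcod rgram u1r; pose d := u1 - u0; pose w (t : R) := u0 + t *: d.
have w0 : w 0 = u0 by rewrite /w scale0r addr0.
have w1 : w 1 = u1 by rewrite /w scale1r addrC subrK.
have wr t : 0 <= t <= 1 -> `|w t - u0| <= r.
  move=> /andP[t0 t1]; rewrite /w addrC addKr normrZ ger0_norm//.
  by apply: le_trans u1r; rewrite ler_piMl.
have wC1 : Ck 1 [set: R] w by exact: segment_C1.
have wcod t : 0 <= t <= 1 -> cod i (w t) by move=> /wr; exact: rcod.
exists (arc_length i w + 0).
  have := curve_cons wC1 wcod (curve_nil A _).
  by rewrite w0 w1.
rewrite addr0 /arc_length.
have cintC : leb.-integrable `[0, 1] (EFin \o (fun=> C * `|d|)).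
  apply: continuous_compact_integrable; first exact: segment_compact.
  by apply: continuous_subspaceT => x; exact: cst_continuous.
apply: (@le_trans _ _ (\int[leb]_(t in `[0, 1]) (C * `|d|))).
  apply: le_Rintegral => //.
    apply: continuous_compact_integrable; first exact: segment_compact.
    apply: continuous_in_subspaceT => t; rewrite inE/= in_itv/= => t01.
    by apply: speed_continuous => //; exact: wcod.
  move=> t; rewrite /= in_itv/= => t01; rewrite derive1_segment.
  by apply: rgram; exact: wr.
by rewrite Rintegral_cst//= lebesgue_measure_itv/= lte01 sube0 mulr1.
Qed.

End StraightSegments.

(** * Riemannian distance versus coordinate distance *)

Section ChartComparison.
Variables (R : realType) (n : nat) (X : metricType R).
Variable A : riemannian_atlas n X.
Hypothesis HA : riemannian_distance A.

(** The straight segment bounds the distance from above. From below, every competing curve, even one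
    leaving the chart, has length at least [c] times the increase of the truncated coordinate
    distance, which starts from 0 at [x0]. *)
Lemma chart_bilipschitz (i : atlas A) (x0 : X) : dom i x0 ->
  exists2 C, 0 < C & \forall x \near x0,
    mdist x0 x <= C * `|coord i x - coord i x0| /\
    `|coord i x - coord i x0| <= C * mdist x0 x.
Proof.
move=> dx0; pose u0 := coord i x0.
have cu0 : cod i u0 by exact: coord_cod.
have [c [C [c0 C0 near_gram]]] :=
  bilin_pos_near (gram_continuous cu0) (gram_pos cu0).
have [r r0 hr] : exists2 r, 0 < r & forall u, `|u - u0| <= r -> cod i u /\
    forall v, c * `|v| <= Num.sqrt (bilin (gram i u) v v) <= C * `|v|.
  have : \forall u \near u0, cod i u /\
      forall v, c * `|v| <= Num.sqrt (bilin (gram i u) v v) <= C * `|v|.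
    apply: filterI => //; apply: open_nbhs_nbhs; split => //; exact: cod_open.
  move=> /nbhs_ballP [e /= e0 he]; exists (e / 2); first by rewrite divr_gt0.
  move=> u ur; apply: he; rewrite -ball_normE /= distrC.
  by apply: le_lt_trans ur _; rewrite ltr_pdivrMr// ltr_pMr// ltr1n.
have rcod u : `|u - u0| <= r -> cod i u by move=> /hr[].
have rc u : `|u - u0| <= r -> forall v,
    c * `|v| <= Num.sqrt (bilin (gram i u) v v).
  by move=> /hr[_ +] v => /(_ v) /andP[].
have rC u : `|u - u0| <= r -> forall v,
    Num.sqrt (bilin (gram i u) v v) <= C * `|v|.
  by move=> /hr[_ +] v => /(_ v) /andP[].
(* The sum dominates both [C], needed for the upper bound, and [c^-1], needed for the lower one. *)
have K0 : 0 < C + c^-1 by rewrite addr_gt0// invr_gt0.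
exists (C + c^-1) => //.
have near_x : \forall x \near x0, dom i x /\ `|coord i x - u0| <= r.
  apply: filterI; first by apply: open_nbhs_nbhs; split=> //; exact: dom_open.
  have xc : `|coord i y - u0| @[y --> x0] --> `|u0 - u0|.
    exact: (chart_norm_continuous (u0 := u0) dx0).
  rewrite subrr normr0 in xc.
  by move/cvgr_lt : xc => /(_ r r0); apply: filterS => y /ltW.
apply: filterS near_x => x [dx xr].
have [l hl lC] := segment_curve rcod rC xr.
rewrite coordK// coordK// in hl.
pose S := [set l | curve_of_length A x0 x l].
(* [riemannian_distance] determines [mdist] only between points joined by a curve; the segment is
   one. *)
have S0 : S !=set0 by exists l.
have dE : mdist x0 x = inf S by exact: HA.
have Slb : has_lbound S by exists 0 => m /curve_of_length_ge0.
split.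
  rewrite dE; apply: (le_trans (ge_inf Slb hl)); apply: (le_trans lC).
  by rewrite ler_wpM2r// lerDl invr_ge0 ltW.
suff h : c * `|coord i x - u0| <= mdist x0 x.
  apply: (@le_trans _ _ (c^-1 * mdist x0 x)).
    by rewrite ler_pdivlMl.
  by rewrite ler_wpM2r ?mdist_ge0// lerDr ltW.
rewrite dE; apply: lb_le_inf => // m Sm.
have := trunc_coord_dist_curve c0 rcod rc Sm.
rewrite !trunc_coord_distE ?subrr ?normr0 ?mulr0 ?subr0//; exact: ltW.
Qed.

End ChartComparison.

(** * Maps that are Lipschitz at a point *)

Lemma differentiable_lipschitz_at (R : realType) (V W : normedModType R)
    (F : V -> W) (a : V) : differentiable F a ->
  exists2 L, 0 < L & \forall u \near a, `|F u - F a| <= L * `|u - a|.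
Proof.
move=> Fa; have [k k0 dk] := linear_lipschitz (diff_continuous Fa).
exists (1 + k); first by rewrite addr_gt0.
(* The remainder is [o(u - a)], hence at most [|u - a|] near [a]; this is the 1 in [1 + k]. *)
have /eqaddoP /(_ 1 ltr01) := diff_locally Fa.
move=> /nbhs_ballP [e /= e0 he].
apply/nbhs_ballP; exists e => //= u; rewrite -ball_normE/= distrC => ua.
have /he : ball 0 e (u - a) by rewrite -ball_normE/= sub0r normrN.
rewrite /= !fctE /= subrK mul1r => h.
have -> : F u - F a = (F u - (F a + 'd F a (u - a))) + 'd F a (u - a).
  by rewrite opprD addrA subrK.
by rewrite (le_trans (ler_normD _ _))// mulrDl mul1r lerD.
Qed.

Section LipschitzAt.
Variables (R : realType).

(** One of the two points is fixed at [x]: only distances to the orbit of [p] have to be followed,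
    and differentiability at a single point yields this much. *)
Definition lipschitz_at (X : metricType R) (T : X -> X) (x : X) :=
  exists2 L, 0 < L & \forall y \near x, mdist (T x) (T y) <= L * mdist x y.

Lemma lipschitz_at_continuous (X : metricType R) (T : X -> X) (x : X) :
  lipschitz_at T x -> {for x, continuous T}.
Proof.
move=> [L L0 TL]; apply/cvg_ballP => e e0.
have : nbhs x (ball x (e / L)) by apply: nbhsx_ballx; rewrite divr_gt0.
move=> xe; near=> y; rewrite ballEmdist/=.
have xy : ball x (e / L) y by near: y.
have Txy : mdist (T x) (T y) <= L * mdist x y by near: y.
apply: (le_lt_trans Txy).
by move: xy; rewrite ballEmdist/= ltr_pdivlMr// mulrC.
Unshelve. all: by end_near. Qed.

Lemma lipschitz_at_iter (X : metricType R) (T : X -> X) (x : X) m :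
  (forall k, lipschitz_at T (iter k T x)) -> lipschitz_at (iter m T) x.
Proof.
move=> Tx; elim: m => [|m IH].
  by exists 1 => //; apply: nearW => y; rewrite mul1r.
have [L L0 TL] := Tx m; have [L' L'0 TL'] := IH.
exists (L * L'); first by rewrite mulr_gt0.
(* Continuity of the iterate at [x] pulls the neighbourhood of [iter m T x] back to one of [x]. *)
have TLm := lipschitz_at_continuous IH TL.
near=> y; rewrite !iterS.
apply: (@le_trans _ _ (L * mdist (iter m T x) (iter m T y))).
  by near: y; exact: TLm.
by rewrite -mulrA ler_pM2l//; near: y.
Unshelve. all: by end_near. Qed.

(** In charts around [x] and [T x] the map is differentiable, hence Lipschitz at the coordinates of
    [x]; [chart_bilipschitz] at both points turns this into a statement on [mdist]. *)
Lemma C1_on_lipschitz_at n (X : metricType R) (A : riemannian_atlas n X)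
    (W : set X) (T : X -> X) (x : X) :
  riemannian_distance A -> C1_on A W T -> W x -> lipschitz_at T x.
Proof.
move=> HA [Tc TC1] Wx.
have [i dx] := dom_cover A x; have [j dTx] := dom_cover A (T x).
pose F := coord j \o T \o param i.
have [C C0 hC] := chart_bilipschitz HA dx.
have [C' C'0 hC'] := chart_bilipschitz HA dTx.
have Fd : differentiable F (coord i x).
  have [Fd _] := TC1 i j; apply: Fd; split; first exact: coord_cod.
  by rewrite /= coordK//; split.
have [L L0 FL] := differentiable_lipschitz_at Fd.
have FLx : \forall y \near x,
    `|F (coord i y) - F (coord i x)| <= L * `|coord i y - coord i x|.
  exact: (coord_continuous dx FL).
(* Continuity of [T] at [x] brings [T y] into the neighbourhood of [T x] where the chart comparison
   holds. *)
have TC' := Tc _ Wx _ hC'.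
have dn : \forall y \near x, dom i y.
  by apply: open_nbhs_nbhs; split => //; exact: dom_open.
exists (C' * (L * C)); first by rewrite !mulr_gt0.
near=> y.
have dy : dom i y by near: y.
have [Ty _] : mdist (T x) (T y) <= C' * `|coord j (T y) - coord j (T x)| /\
    `|coord j (T y) - coord j (T x)| <= C' * mdist (T x) (T y).
  by near: y; exact: TC'.
have [_ xy] : mdist x y <= C * `|coord i y - coord i x| /\
    `|coord i y - coord i x| <= C * mdist x y by near: y.
have : `|F (coord i y) - F (coord i x)| <= L * `|coord i y - coord i x|.
  by near: y.
rewrite /F /= !coordK// => Fxy.
apply: (le_trans Ty); rewrite -!mulrA ler_pM2l//.
by apply: (le_trans Fxy); rewrite ler_pM2l.
Unshelve. all: by end_near. Qed.

End LipschitzAt.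

(** * Birkhoff sums along close returns to the periodic point *)

Section CloseReturns.
Variables (R : realType) (X : pointedMetricType R).
Variables (T : X -> X) (phi : X -> R) (p : X) (tau : nat) (rho : R).

Lemma sum_multiples_le (a : nat -> R) (l : nat) : (0 < tau)%N ->
  (forall k, 0 <= a k) ->
  \sum_(0 <= i < l) a (i * tau)%N <= \sum_(0 <= k < l * tau) a k.
Proof.
move=> tau0 a0; elim: l => [|l IH]; first by rewrite mul0n !big_geq.
rewrite big_nat_recr//= [leRHS](@big_cat_nat _ _ _ (l * tau)%N)//=; last first.
  by apply: leq_mul.
rewrite lerD// mulSn big_ltn; last by rewrite -[ltnLHS]add0n ltn_add2r.
by rewrite lerDl sumr_ge0.
Qed.

(** Adding [rho] makes all terms nonnegative, so the [l] large values at multiples of [tau] may be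
    kept alone. Each is worth [Q * (alpha + rho)], which repays the [l * Q * rho] added. *)
Lemma birkhoff_sum_ge (Q l : nat) (alpha : R) (y : X) :
  (0 < tau)%N -> (tau <= Q)%N -> 0 <= rho -> (forall x, - rho < phi x) ->
  (forall i, (i < l)%N ->
     Q%:R * (alpha + rho) <= phi (iter (i * tau) T y)) ->
  (l * Q)%:R * alpha <= birkhoff_sum (T : borel X -> borel X) phi (l * Q) y.
Proof.
move=> tau0 tauQ rho0 phirho hy.
pose a k := phi (iter k T y) + rho.
have a0 k : 0 <= a k by rewrite /a -lerBlDr sub0r ltW.
have sumE : birkhoff_sum (T : borel X -> borel X) phi (l * Q) y + (l * Q)%:R * rho =
    \sum_(0 <= k < l * Q) a k.
  by rewrite big_split/= sumr_const_nat subn0 mulr_natl.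
have le1 : \sum_(0 <= k < l * tau) a k <= \sum_(0 <= k < l * Q) a k.
  rewrite [leRHS](@big_cat_nat _ _ _ (l * tau)%N)//=; last first.
    by rewrite leq_mul2l tauQ orbT.
  by rewrite lerDl sumr_ge0.
have le2 : \sum_(0 <= i < l) (Q%:R * (alpha + rho)) <=
    \sum_(0 <= i < l) a (i * tau)%N.
  rewrite !big_nat; apply: ler_sum => i /= il.
  by rewrite /a (le_trans (hy _ il))// lerDl.
have := le_trans le2 (le_trans (sum_multiples_le l tau0 a0) le1).
rewrite -sumE sumr_const_nat subn0 => h.
rewrite -(lerD2r ((l * Q)%:R * rho)) -mulrDr.
by apply: le_trans h; rewrite natrM -mulrA [l%:R * _]mulr_natl.
Qed.

(** The expansion bound on [S] is local; [L ^+ l * r <= e] keeps the iterates within its range up to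
    time [l]. *)
Lemma iter_dist_lt (S : X -> X) (L e r : R) (l : nat) (y : X) : 1 <= L ->
  (forall z, mdist p z < e -> mdist p (S z) <= L * mdist p z) ->
  L ^+ l * r <= e -> mdist p y < r ->
  forall i, (i <= l)%N -> mdist p (iter i S y) < L ^+ i * r.
Proof.
move=> L1 SL lre yr; have r0 : 0 < r by apply: le_lt_trans yr; exact: mdist_ge0.
elim=> [_|i IH il]; first by rewrite mul1r.
have := IH (ltnW il) => hi; rewrite iterS.
have L0 : 0 < L by exact: lt_le_trans L1.
apply: (le_lt_trans (SL _ _)); last by rewrite exprS -mulrA ltr_pM2l.
apply: (lt_le_trans hi); apply: le_trans lre.
by rewrite ler_pM2r// ler_weXn2l// ltnW.
Qed.

(** A return at time [k >= B ^ l] lies within [(2 * L) ^- l] of [p], so [l] iterates of [T^tau],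
    each expanding by at most [L], remain within [2 ^- l]. The base [B] is fixed before [Q], since
    [Q] is later taken large in terms of [B]; only [l0] depends on [Q]. *)
Lemma birkhoff_sum_close_return (gamma alpha : R) :
  (0 < tau)%N -> iter tau T p = p -> lipschitz_at (iter tau T) p ->
  0 < gamma -> 0 <= rho -> (forall x, - rho < phi x) ->
  phi x @[x --> p^'] --> +oo ->
  exists2 B, (1 < B)%N & forall Q, (tau <= Q)%N -> exists l0, forall l k y,
    (l0 <= l)%N -> (B ^ l <= k)%N -> ball p (k%:R `^ (- gamma)) y ->
    (forall j, iter j T y <> p) ->
    (l * Q)%:R * alpha <= birkhoff_sum (T : borel X -> borel X) phi (l * Q) y.
Proof.
move=> tau0 Hp [L' L'0 TL'] gamma0 rho0 phirho phiy.
(* Taking [L >= 1] makes the powers of [L] nondecreasing. *)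
pose L := 1 + L'; have L1 : 1 <= L by rewrite lerDl ltW.
have L0 : 0 < L by exact: lt_le_trans L1.
have [e0 /= e00 TL] : exists2 e, 0 < e & forall z, mdist p z < e ->
    mdist p (iter tau T z) <= L * mdist p z.
  move/nbhs_ballP : TL' => [e /= e0 he]; exists e => // z ze.
  have := he z; rewrite ballEmdist /= Hp => /(_ ze) /le_trans; apply.
  by rewrite ler_wpM2r ?mdist_ge0// lerDr.
(* Chosen so that [B ^ gamma >= 2 * L]; the second successor also ensures [1 < B]. *)
pose B := (Num.truncn ((2 * L) `^ gamma^-1)).+2.
have BL : 2 * L <= B%:R `^ gamma.
  have -> : 2 * L = ((2 * L) `^ gamma^-1) `^ gamma.
    by rewrite -powRrM mulVf ?gt_eqF// powRr1// mulr_ge0// ltW.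
  apply: ge0_ler_powR; rewrite ?nnegrE ?powR_ge0//; first exact: ltW.
  rewrite ltW//; apply: lt_trans (truncnS_gt _) _.
  by rewrite ltr_nat.
exists B => // Q tauQ.
(* The limit says nothing of [phi p], which is why the orbit of [y] has to avoid [p]. *)
have [d d0 hd] : exists2 d, 0 < d & forall x, mdist p x < d -> x <> p ->
    Q%:R * (alpha + rho) <= phi x.
  have /cvgryPge /(_ (Q%:R * (alpha + rho))) := phiy.
  move=> /nbhs_ballP [d /= d0 hd]; exists d => // x xd xp.
  by apply: hd; [rewrite ballEmdist|exact/eqP].
pose m := Num.min e0 d; have m0 : 0 < m by rewrite lt_min e00.
have [l0 hl0] : exists l0 : nat, forall l, (l0 <= l)%N -> (2%:R ^+ l)^-1 <= m.
  exists (Num.truncn m^-1).+1 => l hl.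
  rewrite invf_ple ?posrE ?exprn_gt0//.
  apply/ltW/(lt_le_trans (truncnS_gt _)).
  rewrite -natrX ler_nat; apply: leq_trans hl _.
  exact/ltnW/ltn_expl.
exists l0 => l k y ll0 Bk yk yp.
apply: birkhoff_sum_ge => // i il.
have B0 : (0 < B ^ l)%N by rewrite expn_gt0.
have k0 : (0 < k)%N by exact: leq_trans Bk.
have kr : k%:R `^ (- gamma) <= ((2 * L) ^+ l)^-1.
  rewrite powRN lef_pV2 ?posrE ?exprn_gt0 ?powR_gt0 ?mulr_gt0 ?ltr0n//.
  apply: (@le_trans _ _ ((B ^ l)%:R `^ gamma)).
    have -> : (B ^ l)%:R `^ gamma = (B%:R `^ gamma) ^+ l.
      rewrite natrX -powR_mulrn ?ler0n// -powRrM mulrC powRrM.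
      by rewrite powR_mulrn ?powR_ge0.
    by rewrite lerXn2r ?nnegrE ?powR_ge0// mulr_ge0// ltW.
  by apply: ge0_ler_powR; rewrite ?nnegrE ?ler0n ?ler_nat// ltW.
have lm : L ^+ l * ((2 * L) ^+ l)^-1 <= m.
  rewrite exprMn invfM mulrC -mulrA mulVf ?mulr1; first exact: hl0.
  by rewrite expf_neq0// gt_eqF.
have ykr : mdist p y < ((2 * L) ^+ l)^-1.
  by move: yk; rewrite ballEmdist/= => /lt_le_trans; apply.
have TLm z : mdist p z < m -> mdist p (iter tau T z) <= L * mdist p z.
  by rewrite lt_min => /andP[/TL].
have := iter_dist_lt L1 TLm lm ykr (ltnW il); rewrite -iterM => hi.
apply: hd; last exact: yp.
apply: (lt_le_trans hi); apply: (@le_trans _ _ m); last by rewrite ge_min lexx orbT.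
apply: le_trans lm; apply: ler_wpM2r.
  by rewrite invr_ge0 exprn_ge0// mulr_ge0// ltW.
by rewrite ler_weXn2l// ltnW.
Qed.

End CloseReturns.

(** * Borel-Cantelli over geometric blocks of times *)

Section InvariantMeasure.
Context {R : realType} {d : measure_display} {Y : measurableType d}.
Variables (mu : probability Y R) (T : Y -> Y).
Hypothesis HT : preserves mu T.

Lemma measurable_iter k : measurable_fun [set: Y] (iter k T).
Proof.
elim: k => [|k IH]; first exact: measurable_id.
have -> : iter k.+1 T = T \o iter k T by [].
exact: measurableT_comp HT.1 IH.
Qed.

Lemma measurable_iter_preimage k (S : set Y) :
  measurable S -> measurable (iter k T @^-1` S).
Proof. by move=> mS; rewrite -[X in measurable X]setTI; exact: measurable_iter. Qed.

Lemma measure_iter_preimage k (S : set Y) :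
  measurable S -> mu (iter k T @^-1` S) = mu S.
Proof.
move=> mS; elim: k => [//|k IH].
have -> : iter k.+1 T @^-1` S = T @^-1` (iter k T @^-1` S).
  by apply/funext => x; rewrite /preimage /mkset/= -iterSr.
by rewrite HT.2//; exact: measurable_iter_preimage.
Qed.

Lemma measurable_birkhoff_sum (phi : Y -> R) n :
  measurable_fun [set: Y] phi -> measurable_fun [set: Y] (birkhoff_sum T phi n).
Proof.
move=> mphi; apply: measurable_sum => k.
exact: measurableT_comp mphi (measurable_iter k).
Qed.

(** By invariance, the union of the preimages of [E l] over [B ^ l.+1] times has measure at most
    [B / 2 ^ l], which is summable. *)
Lemma block_borel_cantelli (E : (set Y)^nat) (B : nat) : (0 < B)%N ->
  (forall l, measurable (E l)) ->
  (forall l, mu (E l) <= (((2 * B)%:R^-1) ^+ l)%:E)%E ->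
  mu.-negligible [set x | forall m, exists l k,
    [/\ (m <= l)%N, (k < B ^ l.+1)%N & E l (iter k T x)]].
Proof.
move=> B0 mE muE.
pose D l := \big[setU/set0]_(k < B ^ l.+1) (iter k T @^-1` E l).
have mD l : measurable (D l).
  by apply: bigsetU_measurable => k _; exact: measurable_iter_preimage.
(* The bound [B / 2 ^ l] is written in the shape that [epsilon_trick0] sums. *)
have muD l : (mu (D l) <= ((2 * B)%:R / (2 ^ l.+1)%:R)%:E)%E.
  apply: (@le_trans _ _ (\sum_(k < B ^ l.+1) mu (iter k T @^-1` E l))%E).
    apply: (Boole_inequality mu (A := fun k => iter k T @^-1` E l)) => k _.
    exact: measurable_iter_preimage.
  apply: (@le_trans _ _ (\sum_(k < B ^ l.+1) (((2 * B)%:R^-1) ^+ l)%:E)%E).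
    by apply: lee_sum => k _; rewrite measure_iter_preimage.
  rewrite sumEFin lee_fin sumr_const card_ord -[leLHS]mulr_natr.
  have b0 : B%:R ^+ l != 0 :> R by rewrite expf_neq0// pnatr_eq0 -lt0n.
  have t0 : 2%:R ^+ l != 0 :> R by rewrite expf_neq0// pnatr_eq0.
  rewrite exprVn !natrX [(2 * B)%:R]natrM exprMn !exprS.
  rewrite le_eqVlt; apply/orP; left; apply/eqP.
  move: b0 t0; move: (B%:R ^+ l) (2%:R ^+ l) => b t b0 t0.
  by field; rewrite b0 t0.
exists (lim_sup_set D); split.
- apply: bigcapT_measurable => m; apply: bigcup_measurable => l _.
  exact: mD.
- apply: lim_sup_set_cvg0 => //.
  apply: (@le_lt_trans _ _ ((2 * B)%:R%:E)); last exact: ltry.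
  have B2 : 0 <= (2 * B)%:R :> R by [].
  apply: le_trans (epsilon_trick0 xpredT B2).
  apply: lee_nneseries => [l _ _|l _]; first exact: measure_ge0.
  exact: muD.
- move=> x hx m _; have [l [k [ml kB Ex]]] := hx m.
  exists l => //.
  have -> : D l = \bigcup_(k < B ^ l.+1) (iter k T @^-1` E l).
    by rewrite bigcup_mkord.
  by exists k.
Qed.

End InvariantMeasure.

(** * Exponential rates, and Birkhoff sums on a periodic orbit *)

(* The lower bound comes from [lne 0 = -oo]. *)
Lemma exponential_rate_bounds (R : realType) (x : nat -> \bar R) (I : R) :
  0 < I -> (forall n, (0 <= x n)%E) -> (forall n, x n \is a fin_num) ->
  ((n%:R^-1)%:E * lne (x n))%E @[n --> \oo] --> (- I)%:E ->
  \forall n \near \oo,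
    (0 < x n)%E /\ (x n <= (expR (- (I / 2) * n%:R))%:E)%E.
Proof.
move=> I0 x0 xfin xI.
have hi : \forall n \near \oo,
    ((n%:R^-1)%:E * lne (x n) < (- (I / 2))%:E)%E.
  apply: (xI [set y | (y < (- (I / 2))%:E)%E]).
  apply: open_nbhs_nbhs; split; first exact: open_ereal_lt_ereal.
  by rewrite /= lte_fin ltrN2 ltr_pdivrMr// ltr_pMr// ltr1n.
have lo : \forall n \near \oo,
    ((- (I + 1))%:E < (n%:R^-1)%:E * lne (x n))%E.
  apply: (xI [set y | ((- (I + 1))%:E < y)%E]).
  apply: open_nbhs_nbhs; split; first exact: open_ereal_gt_ereal.
  by rewrite /= lte_fin ltrN2 ltrDl.
near=> n.
have n0 : 0 < n%:R :> R by rewrite ltr0n; near: n; exact: nbhs_infty_gt.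
have xlo : ((- (I + 1))%:E < (n%:R^-1)%:E * lne (x n))%E by near: n.
have xhi : ((n%:R^-1)%:E * lne (x n) < (- (I / 2))%:E)%E by near: n.
have xn0 : (0 < x n)%E.
  rewrite lt_neqAle x0 andbT; apply/negP => /eqP xn0.
  by move: xlo; rewrite -xn0 le0_lneNy// gt0_muleNy ?lte_fin ?invr_gt0.
split=> //.
move: xhi xn0; rewrite -(fineK (xfin n)); set r := fine _ => + r0.
rewrite lte_fin in r0.
rewrite lne_EFin// -EFinM lte_fin ltr_pdivrMl// mulrC => /ltW h.
by rewrite lee_fin -(lnK r0) ler_expR.
Unshelve. all: by end_near. Qed.

(** The sum over one period does not depend on where in the orbit it starts, so the right-hand side
    is free of [j]. *)
Lemma birkhoff_sum_periodic (R : realType) (d : measure_display)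
    (Y : measurableType d) (T : Y -> Y) (phi : Y -> R) (p : Y) (tau j q : nat) :
  iter tau T p = p ->
  birkhoff_sum T phi (q * tau) (iter j T p) = q%:R * birkhoff_sum T phi tau p.
Proof.
move=> Hp; pose a k := phi (iter k T p).
have aper k : a (k + tau)%N = a k by rewrite /a iterD Hp.
have shift1 i : \sum_(0 <= k < tau) a (k + i)%N = \sum_(0 <= k < tau) a k.
  elim: i => [|i IH]; first by under eq_bigr do rewrite addn0.
  (* A sum of [tau + 1] consecutive terms is peeled at either end; the two end terms agree by
     periodicity. *)
  rewrite -IH; apply: (@addrI _ (a i)).
  have <- : \sum_(0 <= k < tau.+1) a (k + i)%N =
      a i + \sum_(0 <= k < tau) a (k + i.+1)%N.
    by rewrite big_nat_recl//=; under eq_bigr do rewrite addSnnS.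
  by rewrite big_nat_recr//= addnC aper addrC.
elim: q => [|q IH]; first by rewrite mul0r /birkhoff_sum big_geq.
rewrite /birkhoff_sum mulSnr (@big_cat_nat _ _ _ (q * tau)%N) ?leq_addr//=.
rewrite -/(birkhoff_sum T phi (q * tau) (iter j T p)) IH -natr1 mulrDl mul1r.
congr (_ + _); rewrite -{1}[(q * tau)%N]add0n big_addn addKn.
rewrite -(shift1 (q * tau + j)%N); apply: eq_bigr => k _.
by rewrite -iterD addnA.
Qed.

(** * The orbit of [p] carries the measure *)

Definition forward_orbit (Y : Type) (T : Y -> Y) (p : Y) : set Y :=
  [set x | exists j, x = iter j T p].

Section PeriodicPoint.
Variables (R : realType) (X : pointedMetricType R).
Variables (mu : probability (borel X) R) (T : borel X -> borel X).
Variables (p : borel X) (phi : borel X -> R).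
Hypothesis HT : preserves mu T.

Lemma measurable_point (x : borel X) : measurable [set x].
Proof.
rewrite -[X in measurable X]setCK; apply: measurableC.
apply: sub_sigma_algebra; rewrite openC.
exact: (accessible_closed_set1 (hausdorff_accessible (@metric_hausdorff R X))).
Qed.

Local Notation O := (forward_orbit T p).

Lemma measurable_orbit : measurable O.
Proof.
have -> : O = \bigcup_j [set iter j T p].
  by apply/seteqP; split=> [x [j ->]|x [j _ ->]]; exists j.
by apply: bigcup_measurable => j _; exact: measurable_point.
Qed.

(** A point outside [O] either never reaches [p] or lies in some [T^-k O] minus [O]. The latter set
    is null: [O] is contained in [T^-k O], and the two have the same finite measure. *)
Lemma orbit_full_measure :
  mu.-negligible [set x | forall j, iter j T x <> p] -> mu O = 1%E.
Proof.
move=> G0; have mO := measurable_orbit.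
suff OC0 : mu.-negligible (~` O).
  have := probability_setT mu.
  have -> : [set: borel X] = O `|` ~` O by rewrite setUv.
  rewrite measureU ?setICr//; last exact: measurableC.
  by rewrite (measure_negligible (measurableC mO) OC0) adde0.
have OT k : O `<=` iter k T @^-1` O.
  by move=> _ [j ->]; exists (k + j)%N; rewrite /= iterD.
have Ok k : mu.-negligible (iter k T @^-1` O `\` O).
  have mk := measurable_iter_preimage HT k mO.
  apply/(negligibleP mu (measurableD mk mO)).
  rewrite measureD//; last by rewrite ltey_eq fin_num_measure.
  rewrite setIidr; last exact: OT.
  have muk := measure_iter_preimage HT k mO.
  transitivity (mu O - mu O)%E; last by rewrite subee// fin_num_measure.
  by congr (_ - _)%E; exact: muk.
apply: negligibleS (negligibleU G0 (negligible_bigcup Ok)) => x Ox.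
have [[j xj]|xp] := pselect (exists j, iter j T x = p); last first.
  by left => j xj; apply: xp; exists j.
by right; exists j => //; split => //; exists 0%N; rewrite /= xj.
Qed.

(** A close return at a time [k] in [[B^l, B^(l+1))] forces, for a point avoiding [p], a large
    Birkhoff sum of length [l * Q] from time [k] on. This has probability at most [(2 * B) ^- l],
    small enough to beat the number of such [k]. *)
Lemma avoiding_negligible (tau : nat) (gamma rho alpha c : R) (n0 : nat) :
  (0 < tau)%N -> iter tau T p = p ->
  @lipschitz_at R X (iter tau T) p -> 0 < gamma -> 0 <= rho ->
  measurable_fun [set: borel X] phi -> (forall x, - rho < phi x) ->
  (phi : X -> R) x @[x --> (p : X)^'] --> +oo ->
  {ae mu, forall x : borel X,
     infinite_set [set k | ball (p : X) (k%:R `^ (- gamma)) (iter k T x)]} ->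
  0 < c ->
  (forall n, (n0 <= n)%N ->
    (mu [set x | (n%:R * alpha <= birkhoff_sum T phi n x)%R]
       <= (expR (- c * n%:R))%:E)%E) ->
  mu.-negligible [set x | forall j, iter j T x <> p].
Proof.
move=> tau0 Hp TL gamma0 rho0 mphi phirho phiy Hrec c0 ldp.
have [B B1 hB] :=
  birkhoff_sum_close_return alpha tau0 Hp TL gamma0 rho0 phirho phiy.
have B0 : (0 < B)%N by exact: ltnW.
(* Makes [c * Q >= 2 * B], hence [exp (c * Q) >= 2 * B] by [exp x >= 1 + x], and also [Q >= tau]. *)
pose Q := ((Num.truncn ((2 * B)%:R / c)%R).+1 + tau)%N.
have Qc : expR (- c * Q%:R) <= (2 * B)%:R^-1.
  rewrite mulNr expRN lef_pV2 ?posrE ?expR_gt0 ?ltr0n ?muln_gt0//.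
  apply: (le_trans _ (expR_ge1Dx _)); apply: (@le_trans _ _ (c * Q%:R)).
    rewrite mulrC -ler_pdivrMr// ltW//; apply: (lt_le_trans (truncnS_gt _)).
    by rewrite ler_nat leq_addr.
  by rewrite lerDr.
have [l0 hl0] := hB Q (leq_addl _ _).
(* Emptying the first events makes the measure bound hold for every [l] and leaves the limsup
   unchanged. *)
pose E l : set (borel X) := if (maxn n0 l0 <= l)%N then
  [set x | (l * Q)%:R * alpha <= birkhoff_sum T phi (l * Q) x] else set0.
have mE l : measurable (E l).
  rewrite /E; case: ifP => // _.
  rewrite -[X in measurable X]setTI.
  apply: measurable_fun_le => //.
  exact: (measurable_birkhoff_sum HT (l * Q) mphi).
have muE l : (mu (E l) <= (((2 * B)%:R^-1) ^+ l)%:E)%E.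
  rewrite /E; case: ifPn => [|_]; last by rewrite measure0 lee_fin exprn_ge0// invr_ge0.
  rewrite geq_max => /andP[n0l _].
  apply: (le_trans (ldp (l * Q)%N _)).
    by apply: leq_trans n0l _; rewrite leq_pmulr// /Q addSn.
  rewrite lee_fin natrM mulrCA mulrC expRM_natr.
  by rewrite lerXn2r// nnegrE ?expR_ge0// invr_ge0.
have BC := block_borel_cantelli HT B0 mE muE.
apply: (@negligibleS _ _ _ mu _ _ _ (negligibleU Hrec BC)) => x Gx.
have [inf|] := pselect
  (infinite_set [set k | ball (p : X) (k%:R `^ (- gamma)) (iter k T x)]).
  right => m /=.
  pose M := maxn m (maxn n0 l0).
  have [k Bk kx] : exists2 k, (B ^ M <= k)%N &
      ball (p : X) (k%:R `^ (- gamma)) (iter k T x).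
    apply: contrapT => nk; apply: inf.
    apply: (@sub_finite_set _ _ `I_(B ^ M)); last exact: finite_II.
    by move=> k kx /=; rewrite ltnNge; apply/negP => Bk; apply: nk; exists k.
  have k0 : (0 < k)%N by apply: leq_trans Bk; rewrite expn_gt0 B0.
  (* The block index of [k] is [l = trunc_log B k], for which [B ^ l <= k < B ^ l.+1]. *)
  have Ml : (M <= trunc_log B k)%N by exact: trunc_log_max.
  exists (trunc_log B k), k; split.
  - by apply: leq_trans Ml; rewrite leq_maxl.
  - exact: trunc_log_ltn.
  - have nl : (maxn n0 l0 <= trunc_log B k)%N.
      by apply: leq_trans Ml; rewrite leq_maxr.
    rewrite /E nl /=; apply: (hl0 _ k) => //.
    + by move: nl; rewrite geq_max => /andP[].
    + exact: trunc_logP.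
    + by move=> j; rewrite -iterD; exact: Gx.
by move=> ninf; left.
Qed.

End PeriodicPoint.

(** * Contradiction on the periodic orbit *)

Theorem theorem3p1 (R : realType) (n : nat) (X : pointedMetricType R)
    (A : riemannian_atlas n X) (HA : riemannian_distance A)
    (HX : compact [set: X])
    (mu : probability (borel X) R) (T : X -> X) (HT : preserves mu T)
    (p : X) (tau : nat) (tau_gt0 : (0 < tau)%N) (Hp : iter tau T p = p)
    (W : set X) (W_open : open W) (W_orbit : forall k, W (iter k T p))
    (T_C1 : C1_on A W T)
    (gamma : R) (gamma_gt0 : 0 < gamma)
    (Hrec : {ae mu, forall x : borel X,
       infinite_set [set k | ball p (k%:R `^ (- gamma)) (iter k T x)]})
    (phi : X -> R)
    (phi_int : mu.-integrable [set: borel X] (EFin \o phi))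
    (phi_cont : {within ~` [set p], continuous phi})
    (phi_lim : phi x @[x --> p^'] --> +oo)
    (phi_mean : (\int[mu]_x (phi x)%:E = 0)%E)
    (rho : R) (rho_gt0 : 0 < rho) (phi_lb : forall x, - rho < phi x) :
  ~ satisfies_LDP mu T phi.

Proof.
move=> -[U [I [[U0 _] I0 Ieq0 ldp _]]].
have [e /= e0 eU] := (nbhs_ballP (0 : R) U).1 U0.
pose a := e / 2; have a0 : 0 < a by rewrite divr_gt0.
have Ua : U a.
  apply: eU; rewrite -ball_normE/= sub0r normrN gtr0_norm//.
  by rewrite ltr_pdivrMr// ltr_pMr// ltr1n.
have Ia0 : 0 < I a.
  rewrite lt_neqAle I0// andbT eq_sym; apply/eqP => /(Ieq0 _ Ua) a00.
  by rewrite a00 ltxx in a0.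
pose E n := [set x : borel X | n%:R * a <= @birkhoff_sum R _ (borel X) T phi n x].
have mphi : measurable_fun [set: borel X] phi.
  apply/measurable_realfun.measurable_EFinP; exact: (measurable_int mu phi_int).
have mE m : measurable (E m).
  rewrite -[X in measurable X]setTI; apply: measurable_fun_le => //.
  exact: (@measurable_birkhoff_sum R _ (borel X) mu T HT phi m mphi).
have [n0 _ hn0] := exponential_rate_bounds Ia0
  (fun m => measure_ge0 mu (E m)) (fun m => fin_num_measure mu (E m) (mE m))
  (ldp a Ua a0).
have TL : lipschitz_at (iter tau T) p.
  by apply: lipschitz_at_iter => k; exact: C1_on_lipschitz_at HA T_C1 (W_orbit k).
have c0 : 0 < I a / 2 by rewrite divr_gt0.
have G0 := avoiding_negligible HT tau_gt0 Hp TL gamma_gt0 (ltW rho_gt0) mphi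
  phi_lb phi_lim Hrec c0 (fun m hm => (hn0 m hm).2).
have O1 := orbit_full_measure HT G0.
set O := @forward_orbit (borel X) T p in O1.
(* A multiple of [tau] that is at least [n0], so that the rate bounds apply, and positive, so that
   the upper one is below 1. *)
pose q := n0.+1; pose N := (q * tau)%N.
have n0N : (n0 <= N)%N by rewrite /N (leq_trans (leqnSn n0))// leq_pmulr.
have [EN0 EN1] := hn0 N n0N.
have q0 : 0 < q%:R :> R by rewrite ltr0n.
have EO j : E N (iter j T p) <-> tau%:R * a <= @birkhoff_sum R _ (borel X) T phi tau p.
  rewrite /E /= (@birkhoff_sum_periodic R _ (borel X) T phi p tau j q Hp) /N natrM -mulrA.
  by rewrite ler_pM2l.
have mO : measurable O.
  exact: (@measurable_orbit R X T p).
(* Either [E N] contains the orbit and has measure 1, against the upper rate bound, or it misses the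
   orbit and is null, against positivity. *)
have [aS|Sa] := leP (tau%:R * a) (@birkhoff_sum R _ (borel X) T phi tau p).
  have : (mu O <= mu (E N))%E.
    by apply: le_measure; rewrite ?inE// => _ [j ->]; apply/EO.
  move=> /le_trans /(_ EN1); rewrite O1 lee_fin leNgt expR_lt1 mulNr oppr_lt0.
  by rewrite mulr_gt0// /N natrM mulr_gt0// ltr0n.
have : mu (E N) = 0%E.
  apply/eqP; rewrite eq_le measure_ge0 andbT.
  have <- : mu (~` O) = 0%E by rewrite probability_setC// O1 subee.
  apply: le_measure; rewrite ?inE//; first exact: measurableC.
  by move=> x ENx [j xj]; move: ENx; rewrite xj => /EO; rewrite leNgt Sa.
by move=> /esym EN; have /negbT/eqP := lt_eqF EN0; apply; exact: EN.
Qed.
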